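(* Let $(X,d)$ be a compact metric space and let $k$ be a positive integer. If the Hausdorff dimension of $X$ satisfies $\dim_H X>k$, then there exists a Lipschitz map $f:X\to\mathbb{R}^k$ with $f(X)=[0,1]^k$. *)

(* Defs.v *)
From Stdlib Require Import Reals.
Open Scope R_scope.

Definition open_set (M : Metric_Space) (U : Base M -> Prop) : Prop :=
  forall x, U x -> exists r, 0 < r /\ forall y, dist M x y < r -> U y.

Definition compact_space (M : Metric_Space) : Prop :=
  forall (I : Type) (U : I -> Base M -> Prop),
    (forall i, open_set M (U i)) ->
    (forall x, exists i, U i x) ->
    exists l : list I, forall x, exists i, List.In i l /\ U i x.

(* [is_diam A r]: r is the diameter of A (sup of distances; 0 for the empty set).
   Unbounded sets have no (real) diameter. *)
Definition is_diam (M : Metric_Space) (A : Base M -> Prop) (r : R) : Prop :=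
  ((forall x, ~ A x) /\ r = 0) \/
  is_lub (fun t => exists x y, A x /\ A y /\ t = dist M x y) r.

(* r ^ s for r >= 0 and s > 0 (with 0 ^ s = 0). *)
Definition hpow (r s : R) : R :=
  if Rle_dec r 0 then 0 else Rpower r s.

(* H^s_delta(X) = inf { sum_n (diam A_n)^s : X = U_n A_n, diam A_n <= delta },
   H^s(X) = sup_{delta>0} H^s_delta(X).
   [hausdorff_null M s] is the statement H^s(X) = 0, written out literally:
   for every delta > 0 the infimum H^s_delta(X) is 0, i.e. for every eps > 0
   there is a countable delta-cover with sum of (diam)^s < eps. *)
Definition hausdorff_null (M : Metric_Space) (s : R) : Prop :=
  forall delta eps, 0 < delta -> 0 < eps ->
    exists (A : nat -> Base M -> Prop) (r : nat -> R),
      (forall n, is_diam M (A n) (r n) /\ r n <= delta) /\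
      (forall x, exists n, A n x) /\
      exists l, infinite_sum (fun n => hpow (r n) s) l /\ l < eps.

Inductive ereal : Type := Fin : R -> ereal | PInf : ereal.

Definition ereal_lt (a b : ereal) : Prop :=
  match a, b with
  | Fin x, Fin y => x < y
  | Fin _, PInf => True
  | PInf, _ => False
  end.

Definition is_inf_ereal (S : R -> Prop) (e : ereal) : Prop :=
  match e with
  | Fin m => (forall s, S s -> m <= s) /\
             (forall m', (forall s, S s -> m' <= s) -> m' <= m) /\
             (exists s, S s)
  | PInf => forall s, ~ S s
  end.

Definition is_hausdorff_dim (M : Metric_Space) (D : ereal) : Prop :=
  is_inf_ereal (fun s => 0 < s /\ hausdorff_null M s) D.

(* R^k is modelled as [nat -> R], only coordinates 0..k-1 being relevant. *)
Fixpoint sum_upto (n : nat) (g : nat -> R) : R :=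
  match n with
  | O => 0
  | S n' => sum_upto n' g + g n'
  end.

Definition eucl_dist (k : nat) (u v : nat -> R) : R :=
  sqrt (sum_upto k (fun i => (u i - v i) ^ 2)).

Definition lipschitz_to_Rk (M : Metric_Space) (k : nat) (f : Base M -> nat -> R) : Prop :=
  exists L, 0 <= L /\ forall x y, eucl_dist k (f x) (f y) <= L * dist M x y.

Definition image_is_unit_cube (M : Metric_Space) (k : nat) (f : Base M -> nat -> R) : Prop :=
  (forall x i, (i < k)%nat -> 0 <= f x i <= 1) /\
  (forall y : nat -> R, (forall i, (i < k)%nat -> 0 <= y i <= 1) ->
     exists x, forall i, (i < k)%nat -> f x i = y i).

(* Main.v *)
Require Import Defs.
From Stdlib Require Import Reals Lra Lia List Classical ClassicalEpsilon Arith.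
From mathcomp Require filter.
Open Scope R_scope.

(** Fix [s > k] with positive [s]-dimensional Hausdorff measure and [t] with
    [s (1 - 1/t) >= k].  At the resolution [delta], let [C] be the [s]-dimensional
    content of subsets of a finite [delta]-net, and let [Phi_h^E A] be the cheapest
    cover of [A] by sets [S], each inside a ball [B] of radius [3^h delta] centred
    in [E], at the price [C(S) C(B /\ E)^(-1/t)], everything being capped at about
    [(3^h delta)^k].  Around a centre [z] maximising the content of the ball of
    radius [3^h delta], one of the [t] shells of width [2 * 3^h delta / t] can be
    discarded: if [P] is the inside of the shell and [Q] is [P] with the shell, then
    [Phi_(h+1)^E Q <= Phi_h^P P], for otherwise the content would grow [t] times
    by more than the [t]-th root of its total growth.  Splitting off such [P]
    repeatedly, at all scales, and listing the surviving points piece by piece yields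
    about [delta^(-k)] points [x_i] with [d(x_i, x_j) >= c delta |i - j|^(1/k)].
    Matching [x_i] with the [i]-th cell of a discrete Peano curve gives, in the limit
    along an ultrafilter, a map [x] from the cube to the space with
    [|y - y'| <= L d(x y, x y')]; its inverse extends to the whole space coordinate
    by coordinate, by McShane's formula. *)

(** * A discrete Peano curve *)

Section DiscretePeanoCurve.

Local Open Scope nat_scope.

Variable k : nat.

(* Among the [p] ternary digits of an index, the one of weight [3 ^ q] is a digit
   of coordinate [q mod k]; [side c p] is the resulting range of coordinate [c]. *)
Fixpoint side (c p : nat) : nat :=
  match p with
  | O => 1
  | S q => if q mod k =? c then 3 * side c q else side c q
  end.

(* Peano's reflections: an odd leading digit of one coordinate reverses all the
   other coordinates, so that consecutive indices go to adjacent cells. *)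
Fixpoint peano (p t c : nat) : nat :=
  match p with
  | O => 0
  | S q =>
      let d := t / 3 ^ q in
      let v := peano q (t mod 3 ^ q) c in
      if q mod k =? c then d * side c q + v
      else if Nat.even d then v else side c q - 1 - v
  end.

Lemma side_pos (c p : nat) : 0 < side c p.
Proof. induction p; simpl; [lia|]. destruct (_ =? _); lia. Qed.

Lemma pow3_pos (q : nat) : 0 < 3 ^ q.
Proof. induction q; simpl; lia. Qed.

(** Each round of [k] digits serves every coordinate once. Inside a round, after [j] digits, exactly
    the coordinates below [j] are one factor 3 ahead; this is the form proved by induction. *)
Lemma side_mul (c l : nat) : c < k -> side c (k * l) = 3 ^ l.
Proof.
  intros Hc.
  assert (H : forall l j, j <= k ->
            side c (k * l + j) = 3 ^ l * (if c <? j then 3 else 1)).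
  { induction l0 as [|l0 IHl]; induction j as [|j IHj]; intros Hj.
    - now rewrite Nat.mul_0_r.
    - rewrite Nat.add_succ_r. simpl side.
      rewrite IHj by lia. rewrite Nat.mul_0_r, Nat.add_0_l.
      rewrite Nat.mod_small by lia.
      destruct (Nat.eqb_spec j c), (Nat.ltb_spec c j), (Nat.ltb_spec c (S j));
        simpl; lia.
    - replace (k * S l0 + 0) with (k * l0 + k) by lia.
      rewrite IHl by lia. destruct (Nat.ltb_spec c k); simpl; lia.
    - rewrite Nat.add_succ_r. simpl side.
      rewrite IHj by lia.
      replace (k * S l0 + j) with (j + S l0 * k) by lia.
      rewrite Nat.Div0.mod_add, Nat.mod_small by lia.
      destruct (Nat.eqb_spec j c), (Nat.ltb_spec c j), (Nat.ltb_spec c (S j));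
        simpl; lia. }
  specialize (H l 0). rewrite Nat.add_0_r in H. rewrite H by lia. simpl. lia.
Qed.

Lemma digit_lt3 (q t : nat) : t < 3 ^ S q -> t / 3 ^ q < 3.
Proof.
  intros H. apply Nat.Div0.div_lt_upper_bound. simpl in H. lia.
Qed.

Lemma low_lt (q t : nat) : t mod 3 ^ q < 3 ^ q.
Proof. apply Nat.mod_upper_bound. pose proof (pow3_pos q). lia. Qed.

Lemma peano_lt_side (p t c : nat) : t < 3 ^ p -> peano p t c < side c p.
Proof.
  revert t. induction p as [|q IH]; intros t Ht; simpl; [lia|].
  pose proof (digit_lt3 q t Ht). pose proof (IH _ (low_lt q t)).
  destruct (_ =? _).
  - assert (t / 3 ^ q * side c q <= 2 * side c q) by (apply Nat.mul_le_mono_r; lia). lia.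
  - destruct (Nat.even _); lia.
Qed.

Lemma peano_0 (p c : nat) : peano p 0 c = 0.
Proof.
  induction p as [|q IH]; simpl; [easy|].
  rewrite Nat.Div0.div_0_l, Nat.Div0.mod_0_l, IH.
  destruct (_ =? _); simpl; easy.
Qed.

Lemma divmod_block (q d r : nat) :
  r < 3 ^ q -> (d * 3 ^ q + r) / 3 ^ q = d /\ (d * 3 ^ q + r) mod 3 ^ q = r.
Proof.
  intros H. pose proof (pow3_pos q). split.
  - rewrite Nat.div_add_l by lia. rewrite Nat.div_small; lia.
  - rewrite Nat.add_comm, Nat.Div0.mod_add. now apply Nat.mod_small.
Qed.

Lemma peano_last (p c : nat) : peano p (3 ^ p - 1) c = side c p - 1.
Proof.
  induction p as [|q IH]; simpl; [easy|].
  pose proof (pow3_pos q).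
  replace (3 ^ q + (3 ^ q + (3 ^ q + 0)) - 1) with (2 * 3 ^ q + (3 ^ q - 1)) by lia.
  destruct (divmod_block q 2 (3 ^ q - 1)) as [-> ->]; [lia|].
  rewrite IH. pose proof (side_pos c q). destruct (_ =? _); simpl; lia.
Qed.

(** At a carry the low part jumps from the last corner to the first one while the leading digit
    changes parity: the reflected coordinates stay put, and the coordinate of the digit itself
    enters the next layer. *)
Lemma peano_succ (p t c : nat) :
  S t < 3 ^ p ->
  peano p (S t) c <= S (peano p t c) /\ peano p t c <= S (peano p (S t) c).
Proof.
  revert t. induction p as [|q IH]; intros t Ht; [simpl; lia|].
  simpl peano.
  pose proof (pow3_pos q) as Hq.
  pose proof (Nat.div_mod_eq t (3 ^ q)) as Et.
  pose proof (low_lt q t) as Hr.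
  set (d := t / 3 ^ q) in *. set (r := t mod 3 ^ q) in *.
  destruct (Nat.eq_dec (S r) (3 ^ q)) as [E|E].
  - assert (ES : S t = S d * 3 ^ q + 0) by lia. rewrite ES.
    destruct (divmod_block q (S d) 0) as [-> ->]; [lia|].
    replace r with (3 ^ q - 1) by lia.
    rewrite peano_0, peano_last. pose proof (side_pos c q).
    rewrite Nat.even_succ, <- Nat.negb_even.
    destruct (_ =? _); [lia|]. destruct (Nat.even d); simpl; lia.
  - assert (ES : S t = d * 3 ^ q + S r) by lia. rewrite ES.
    destruct (divmod_block q d (S r)) as [-> ->]; [lia|].
    destruct (IH r); [lia|].
    pose proof (peano_lt_side q r c Hr).
    pose proof (peano_lt_side q (S r) c).
    destruct (_ =? _); [lia|]. destruct (Nat.even d); lia.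
Qed.

Lemma div_low (p q t : nat) :
  q <= p -> t / 3 ^ q = t / 3 ^ p * 3 ^ (p - q) + (t mod 3 ^ p) / 3 ^ q.
Proof.
  intros H. pose proof (pow3_pos q).
  rewrite (Nat.div_mod_eq t (3 ^ p)) at 1.
  replace (3 ^ p) with (3 ^ q * 3 ^ (p - q)) at 1
    by (rewrite <- Nat.pow_add_r; f_equal; lia).
  replace (3 ^ q * 3 ^ (p - q) * (t / 3 ^ p)) with (t / 3 ^ p * 3 ^ (p - q) * 3 ^ q)
    by lia.
  now rewrite Nat.div_add_l by lia.
Qed.

(** Equal digits at all weights from [3 ^ q] on cause equal shifts and reflections, so the
    difference is, up to sign, that of two values of the curve with [q] digits. A reflection
    exchanges [t] and [u], hence the induction hypothesis in both orders. *)
Lemma peano_same_block (p q t u c : nat) :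
  q <= p -> t < 3 ^ p -> u < 3 ^ p -> t / 3 ^ q = u / 3 ^ q ->
  peano p t c < peano p u c + side c q.
Proof.
  intros Hqp. revert t u. induction Hqp as [|p Hqp IH]; intros t u Ht Hu E.
  - pose proof (peano_lt_side q t c Ht). lia.
  - pose proof (low_lt p t) as Hrt. pose proof (low_lt p u) as Hru.
    assert (E' : t / 3 ^ p = u / 3 ^ p /\ (t mod 3 ^ p) / 3 ^ q = (u mod 3 ^ p) / 3 ^ q).
    { rewrite (div_low p q t), (div_low p q u) in E by lia.
      assert (HB : forall v, v < 3 ^ p -> v / 3 ^ q < 3 ^ (p - q)).
      { intros v Hv. apply Nat.Div0.div_lt_upper_bound.
        rewrite <- Nat.pow_add_r. now replace (q + (p - q)) with p by lia. }
      apply (Nat.div_mod_unique (3 ^ (p - q))); auto. lia. }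
    destruct E' as [E1 E2].
    pose proof (IH _ _ Hrt Hru E2). pose proof (IH _ _ Hru Hrt (eq_sym E2)).
    pose proof (peano_lt_side p _ c Hrt). pose proof (peano_lt_side p _ c Hru).
    simpl peano. rewrite E1.
    destruct (_ =? _); [lia|]. destruct (Nat.even _); lia.
Qed.

(* A block of length [3 ^ q] is mapped into a box, and consecutive blocks into
   adjacent boxes: this gives the Hölder exponent [1 / k]. *)
Lemma peano_holder (p q t u c : nat) :
  q <= p -> t <= u -> u < 3 ^ p -> u - t < 3 ^ q ->
  peano p t c < peano p u c + 2 * side c q /\
  peano p u c < peano p t c + 2 * side c q.
Proof.
  intros Hqp Htu Hu Hd. pose proof (pow3_pos q) as Hq.
  pose proof (Nat.div_mod_eq t (3 ^ q)) as Et. pose proof (low_lt q t) as Hr.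
  pose proof (Nat.div_mod_eq u (3 ^ q)) as Eu. pose proof (low_lt q u) as Hs.
  set (d := t / 3 ^ q) in *. set (e := u / 3 ^ q) in *.
  set (r := t mod 3 ^ q) in *. set (s := u mod 3 ^ q) in *.
  assert (Hde : e = d \/ e = S d) by nia.
  destruct Hde as [E|E].
  - pose proof (peano_same_block p q t u c). pose proof (peano_same_block p q u t c).
    fold d e in H, H0. lia.
  (* Pass through [b], the last index of the block of [t], and [S b], the first index of the block
     of [u]. *)
  - set (b := d * 3 ^ q + (3 ^ q - 1)).
    assert (Hb : b / 3 ^ q = d) by (apply divmod_block; lia).
    assert (ESb : S b = e * 3 ^ q + 0) by (unfold b; nia).
    assert (HSb : S b / 3 ^ q = e) by (rewrite ESb; apply divmod_block; lia).
    assert (HbU : S b <= u) by nia.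
    pose proof (peano_same_block p q t b c) as H1.
    pose proof (peano_same_block p q b t c) as H2.
    pose proof (peano_same_block p q (S b) u c) as H3.
    pose proof (peano_same_block p q u (S b) c) as H4.
    pose proof (peano_succ p b c).
    fold d in H1, H2. fold e in H3, H4. lia.
Qed.

Lemma peano_surjective (p : nat) (y : nat -> nat) :
  0 < k -> (forall c, c < k -> y c < side c p) ->
  exists t, t < 3 ^ p /\ forall c, c < k -> peano p t c = y c.
Proof.
  intros Hk. revert y. induction p as [|q IH]; intros y Hy.
  - exists 0. split; [simpl; lia|]. intros c Hc. specialize (Hy c Hc). simpl in *. lia.
  - set (c0 := q mod k).
    assert (Hc0 : c0 < k) by (apply Nat.mod_upper_bound; lia).
    set (d := y c0 / side c0 q).
    assert (Hd : d < 3).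
    { apply Nat.Div0.div_lt_upper_bound. pose proof (Hy c0 Hc0) as H. simpl in H.
      fold c0 in H. rewrite Nat.eqb_refl in H. lia. }
    (* The reflection is an involution, so it is undone on the target cell before recursing. *)
    destruct (IH (fun c => if c0 =? c then y c0 mod side c0 q
                           else if Nat.even d then y c else side c q - 1 - y c))
      as [r [Hr Hp]].
    { intros c Hc. pose proof (side_pos c q). specialize (Hy c Hc). simpl in Hy.
      fold c0 in Hy. destruct (Nat.eqb_spec c0 c) as [<-|].
      - apply Nat.mod_upper_bound. lia.
      - destruct (Nat.even d); lia. }
    exists (d * 3 ^ q + r). split; [simpl; nia|].
    intros c Hc. simpl.
    destruct (divmod_block q d r Hr) as [-> ->].
    rewrite (Hp c Hc). fold c0. specialize (Hy c Hc). simpl in Hy. fold c0 in Hy.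
    destruct (Nat.eqb_spec c0 c) as [<-|].
    + pose proof (Nat.div_mod_eq (y c0) (side c0 q)). fold d in H. lia.
    + destruct (Nat.even d); lia.
Qed.

End DiscretePeanoCurve.

(** * Contents defined by finite covers *)

Definition is_glb (E : R -> Prop) (m : R) : Prop :=
  (forall v, E v -> m <= v) /\ (forall b, (forall v, E v -> b <= v) -> b <= m).

(** A total function, meaningful only where [Rinf_is_glb] applies. *)
Definition Rinf (E : R -> Prop) : R := epsilon (inhabits 0) (is_glb E).

Lemma Rinf_is_glb (E : R -> Prop) (b v : R) :
  E v -> (forall w, E w -> b <= w) -> is_glb E (Rinf E).
Proof.
  intros Hv Hb. unfold Rinf. apply epsilon_spec.
  destruct (completeness (fun x => E (- x))) as [m [Hm1 Hm2]].
  - exists (- b). intros x Hx. specialize (Hb _ Hx). lra.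
  - exists (- v). now rewrite Ropp_involutive.
  - exists (- m). split.
    + intros w Hw. assert (- w <= m) by (apply Hm1; now rewrite Ropp_involutive). lra.
    + intros a Ha. enough (m <= - a) by lra. apply Hm2.
      intros x Hx. specialize (Ha _ Hx). lra.
Qed.

Section CoverContent.

Variable X : Type.

(* [W S c] reads: the set [S] may be used in a cover, at price [c]. *)
Implicit Types (W : (X -> Prop) -> R -> Prop) (A B S : X -> Prop).

Definition cost (l : list ((X -> Prop) * R)) : R :=
  fold_right (fun p a => snd p + a) 0 l.

Definition is_cover W A (l : list ((X -> Prop) * R)) : Prop :=
  (forall S c, In (S, c) l -> W S c) /\
  (forall x, A x -> exists S c, In (S, c) l /\ S x).

Definition content W A : R := Rinf (fun v => exists l, is_cover W A l /\ v = cost l).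

(** The first clause bounds the costs below; the second provides a cover of any set, so that
    [content] is a genuine infimum. *)
Definition price_system W : Prop :=
  (forall S c, W S c -> 0 <= c) /\ (exists S c, W S c /\ forall x, S x).

Lemma cost_app l l' : cost (l ++ l') = cost l + cost l'.
Proof. induction l; simpl; lra. Qed.

Lemma cost_ge0 (l : list ((X -> Prop) * R)) :
  (forall S c, In (S, c) l -> 0 <= c) -> 0 <= cost l.
Proof.
  induction l as [|[S c] l IH]; simpl; intros H; [lra|].
  assert (0 <= c) by (apply (H S); auto).
  assert (0 <= cost l) by (apply IH; intros; eapply H; eauto). lra.
Qed.

Lemma cost_ge_item (l : list ((X -> Prop) * R)) S c :
  (forall S c, In (S, c) l -> 0 <= c) -> In (S, c) l -> c <= cost l.
Proof.
  intros H Hin. destruct (in_split _ _ Hin) as [l1 [l2 ->]].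
  rewrite cost_app. simpl.
  assert (0 <= cost l1) by (apply cost_ge0; intros; eapply H; apply in_or_app; eauto).
  assert (0 <= cost l2)
    by (apply cost_ge0; intros; eapply H; apply in_or_app; right; right; eauto).
  lra.
Qed.

Lemma content_is_glb W A :
  price_system W -> is_glb (fun v => exists l, is_cover W A l /\ v = cost l) (content W A).
Proof.
  intros [H0 [S [c [HS HT]]]].
  apply (Rinf_is_glb _ 0 (cost ((S, c) :: nil))).
  - exists ((S, c) :: nil). split; [split|easy].
    + intros S' c' [E|[]]. now inversion E; subst.
    + intros x _. exists S, c. split; [now left|apply HT].
  - intros v [l [[Hl _] ->]]. apply cost_ge0. intros S' c' Hin. eapply H0, Hl, Hin.
Qed.

Lemma content_le_cost W A l : price_system W -> is_cover W A l -> content W A <= cost l.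
Proof. intros HW Hl. apply (content_is_glb W A HW). eauto. Qed.

Lemma le_content W A b :
  price_system W -> (forall l, is_cover W A l -> b <= cost l) -> b <= content W A.
Proof. intros HW Hb. apply (content_is_glb W A HW). intros v [l [Hl ->]]. auto. Qed.

Lemma content_le_price W A S c :
  price_system W -> W S c -> (forall x, A x -> S x) -> content W A <= c.
Proof.
  intros HW HS HA. replace c with (cost ((S, c) :: nil)) by (simpl; lra).
  apply content_le_cost; [easy|split].
  - intros S' c' [E|[]]. now inversion E; subst.
  - intros x Hx. exists S, c. split; [now left|auto].
Qed.

Lemma content_ge0 W A : price_system W -> 0 <= content W A.
Proof.
  intros HW. apply le_content; [easy|]. intros l [Hl _]. apply cost_ge0.
  intros S c Hin. eapply (proj1 HW), Hl, Hin.
Qed.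

Lemma content_empty W A : price_system W -> (forall x, ~ A x) -> content W A = 0.
Proof.
  intros HW HA. apply Rle_antisym; [|now apply content_ge0].
  apply (content_le_cost W A nil HW). split.
  - intros S c [].
  - intros x Hx. now destruct (HA x).
Qed.

Lemma content_mono W W' A A' :
  price_system W -> price_system W' ->
  (forall S c, W' S c -> exists c', c' <= c /\ W S c') ->
  (forall x, A x -> A' x) -> content W A <= content W' A'.
Proof.
  intros HW HW' HWW HA. apply le_content; [easy|]. intros l [Hl Hc].
  enough (H : exists l', is_cover W A l' /\ cost l' <= cost l).
  { destruct H as [l' [H1 H2]]. pose proof (content_le_cost W A l' HW H1). lra. }
  (* Keep the sets of the cover and reprice them one by one. *)
  assert (H : exists l', (forall S c, In (S, c) l' -> W S c) /\
             (forall S c, In (S, c) l -> exists c', In (S, c') l') /\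
             cost l' <= cost l).
  { clear Hc. induction l as [|[S c] l IH].
    - exists nil. repeat split; try easy; simpl; lra.
    - destruct IH as [l' [I1 [I2 I3]]]; [intros; apply Hl; now right|].
      destruct (HWW S c) as [c' [Hc' HS]]; [apply Hl; now left|].
      exists ((S, c') :: l'). repeat split.
      + intros T a [E|Hin]; [now inversion E; subst|auto].
      + intros T a [E|Hin]; [inversion E; subst; exists c'; now left|].
        destruct (I2 _ _ Hin) as [a' Ha']. exists a'. now right.
      + simpl. lra. }
  destruct H as [l' [I1 [I2 I3]]]. exists l'. split; [split; [easy|]|easy].
  intros x Hx. destruct (Hc x (HA x Hx)) as [S [c [Hin HS]]].
  destruct (I2 _ _ Hin) as [c' Hc']. eauto.
Qed.

Lemma content_mono_set W A A' :
  price_system W -> (forall x, A x -> A' x) -> content W A <= content W A'.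
Proof. intros HW. apply content_mono; auto. intros S c H. exists c. split; [lra|easy]. Qed.

Lemma content_union W A B D :
  price_system W -> (forall x, A x -> B x \/ D x) ->
  content W A <= content W B + content W D.
Proof.
  intros HW H. enough (content W A - content W B <= content W D) by lra.
  apply le_content; [easy|]. intros l [Hl1 Hl2].
  enough (content W A - cost l <= content W B) by lra.
  apply le_content; [easy|]. intros l' [Hl1' Hl2'].
  enough (content W A <= cost (l' ++ l)) by (rewrite cost_app in *; lra).
  apply content_le_cost; [easy|split].
  - intros S c Hin. apply in_app_or in Hin as [|]; auto.
  - intros x Hx. destruct (H x Hx) as [HB|HD].
    + destruct (Hl2' x HB) as [S [c [Hin HS]]]. exists S, c.
      split; [apply in_or_app; now left|easy].
    + destruct (Hl2 x HD) as [S [c [Hin HS]]]. exists S, c.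
      split; [apply in_or_app; now right|easy].
Qed.

End CoverContent.

Arguments content {X}. Arguments cost {X}. Arguments is_cover {X}.
Arguments price_system {X}.

Lemma finite_argmax (X : Type) (f : X -> R) (l : list X) (A : X -> Prop) (a : X) :
  (forall x, A x -> In x l) -> A a ->
  exists z, A z /\ forall x, A x -> f x <= f z.
Proof.
  intros Hl Ha. revert A Hl Ha.
  enough (H : forall (A : X -> Prop), (exists a, A a /\ In a l) ->
            exists z, A z /\ forall x, A x -> In x l -> f x <= f z).
  { intros A HA Ha. destruct (H A) as [z [Hz1 Hz2]]; eauto. }
  induction l as [|b l IH]; intros A [c [Hc Hin]]; [easy|].
  destruct (classic (exists a, A a /\ In a l)) as [Hex|Hno].
  - destruct (IH A Hex) as [z [Hz1 Hz2]].
    destruct (classic (A b /\ f z < f b)) as [[Hb1 Hb2]|Hb].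
    + exists b. split; [easy|]. intros x Hx [->|Hi]; [lra|].
      specialize (Hz2 x Hx Hi). lra.
    + exists z. split; [easy|]. intros x Hx [->|Hi]; [|auto].
      destruct (Rle_or_lt (f x) (f z)); [easy|tauto].
  - exists c. split; [easy|]. intros x Hx Hi.
    assert (Hb : forall y, A y -> In y (b :: l) -> y = b).
    { intros y Hy [->|Hy2]; [easy|]. destruct Hno. eauto. }
    rewrite (Hb x Hx Hi), (Hb c Hc Hin). lra.
Qed.

(** * Extracting separated points *)

Section BallGrowing.

Variable M : Metric_Space.
Let X := Base M.

Definition closed_ball (z : X) (r : R) (x : X) : Prop := dist M z x <= r.

Lemma dist_refl0 (x : X) : dist M x x = 0.
Proof. now apply dist_refl. Qed.

Lemma ball_center (z : X) (r : R) : 0 <= r -> closed_ball z r z.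
Proof. unfold closed_ball. now rewrite dist_refl0. Qed.

Variable C : (X -> Prop) -> R.
Hypothesis C_pos : forall (A : X -> Prop) a, A a -> 0 < C A.
Hypothesis C_ge0 : forall A, 0 <= C A.
Hypothesis C_empty : forall A : X -> Prop, (forall x, ~ A x) -> C A = 0.
Hypothesis C_mono : forall A B : X -> Prop, (forall x, A x -> B x) -> C A <= C B.
Hypothesis C_union : forall A B D : X -> Prop,
  (forall x, A x -> B x \/ D x) -> C A <= C B + C D.

Variable t : nat.
Hypothesis t_pos : (0 < t)%nat.
Variable r0 : R.
Hypothesis r0_pos : 0 < r0.
Variable K : nat.
Variable u : R.
Hypothesis u_pos : 0 < u.

Definition radius (h : nat) : R := 3 ^ h * r0.
(** The width of [t] equal shells filling the space between the radii of scales [h] and [S h]. *)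
Definition gap (h : nat) : R := 2 * radius h / INR t.
(** With [K = 3 ^ k] and [u] proportional to [r0 ^ k], this is the [k]-th power of the radius up to
    a constant. It is also the weight of [K ^ h] points of weight [u] each. *)
Definition cap (h : nat) : R := INR (K ^ h) * u.

Variable H : nat.
(** This is where the excess of the dimension over [k] enters: it keeps the cap from being the
    binding price in [exists_cheap_shell]. *)
Hypothesis C_ball_le_cap : forall h z (A : X -> Prop) a, (h < H)%nat -> A a ->
  (forall x, A x -> closed_ball z (radius (S h)) x) ->
  Rpower (C A) (1 - / INR t) <= cap h.

(* Charging [C S * C(B)^(-1/t)] rather than [C(B)^(1 - 1/t)], where [B] is the
   relative ball at scale [h] that contains [S], is what makes the losses of
   the successive scales telescope. *)
Definition price (h : nat) (E S : X -> Prop) (c : R) : Prop :=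
  c = cap h \/
  exists z, E z /\ (forall x, S x -> closed_ball z (radius h) x) /\
    c = C S * Rpower (C (fun x => closed_ball z (radius h) x /\ E x)) (- / INR t).

Definition Phi (h : nat) (E A : X -> Prop) : R := content (price h E) A.

Lemma INR_t_pos : 0 < INR t.
Proof. now apply lt_0_INR. Qed.

Lemma radius_pos h : 0 < radius h.
Proof. apply Rmult_lt_0_compat; [apply pow_lt; lra|easy]. Qed.

Lemma gap_pos h : 0 < gap h.
Proof.
  unfold gap, Rdiv. pose proof (radius_pos h). pose proof INR_t_pos.
  apply Rmult_lt_0_compat; [lra|now apply Rinv_0_lt_compat].
Qed.

Lemma radius_S h : radius (S h) = radius h + INR t * gap h.
Proof. unfold gap, radius. simpl. field. pose proof INR_t_pos. lra. Qed.

Lemma gap_mono l h : (l <= h)%nat -> gap l <= gap h.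
Proof.
  intros Hlh. unfold gap, radius, Rdiv. pose proof INR_t_pos as Ht.
  apply Rinv_0_lt_compat in Ht. apply Rmult_le_compat_r; [lra|].
  apply Rmult_le_compat_l; [lra|]. apply Rmult_le_compat_r; [lra|].
  apply Rle_pow; [lra|easy].
Qed.

Lemma price_ok h E : price_system (price h E).
Proof.
  assert (Hc : 0 <= cap h) by (apply Rmult_le_pos; [apply pos_INR|lra]).
  split.
  - intros S c [->|[z [_ [_ ->]]]]; [easy|].
    apply Rmult_le_pos; [apply C_ge0|unfold Rpower; left; apply exp_pos].
  - exists (fun _ => True), (cap h). split; [now left|easy].
Qed.

Lemma Phi_le_cap h E A : Phi h E A <= cap h.
Proof.
  apply (content_le_price _ _ _ (fun _ => True)); [apply price_ok|now left|easy].
Qed.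

Lemma Rpower_neg_le a b e : 0 < a -> a <= b -> 0 <= e -> Rpower b (- e) <= Rpower a (- e).
Proof.
  intros Ha Hab He. rewrite !Rpower_Ropp.
  apply Rinv_le_contravar; [apply exp_pos|]. now apply Rle_Rpower_l.
Qed.

Lemma inv_t_ge0 : 0 <= / INR t.
Proof. left. apply Rinv_0_lt_compat, INR_t_pos. Qed.

(** Shrinking the reference set leaves fewer centres and lighter relative balls, whose negative
    powers are larger. *)
Lemma Phi_antitone h (E E' A : X -> Prop) :
  (forall x, E' x -> E x) -> Phi h E A <= Phi h E' A.
Proof.
  intros HE. apply content_mono; [apply price_ok|apply price_ok| |easy].
  intros S c [->|[z [Hz [HS ->]]]].
  - exists (cap h). split; [lra|now left].
  - eexists. split; [|right; exists z; eauto].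
    apply Rmult_le_compat_l; [apply C_ge0|].
    apply Rpower_neg_le; [|apply C_mono; intros x [? ?]; auto|apply inv_t_ge0].
    apply (C_pos _ z). split; [apply ball_center; left; apply radius_pos|easy].
Qed.

Lemma C_le_sum (l : list ((X -> Prop) * R)) (A : X -> Prop) (q : R) :
  0 <= q ->
  (forall S c, In (S, c) l -> C S * q <= c) ->
  (forall x, A x -> exists S c, In (S, c) l /\ S x) ->
  C A * q <= cost l.
Proof.
  intros Hq. revert A. induction l as [|[S c] l IH]; intros A Hl HA.
  - rewrite C_empty; [simpl; lra|]. intros x Hx. now destruct (HA x Hx) as [? [? [[] _]]].
  - assert (H1 : C S * q <= c) by (apply Hl; now left).
    set (B := fun x => exists S c, In (S, c) l /\ S x).
    assert (H2 : C B * q <= cost l) by (apply IH; [intros; apply Hl; now right|easy]).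
    assert (H3 : C A <= C S + C B).
    { apply C_union. intros x Hx. destruct (HA x Hx) as [T [a [[E|Hin] HT]]].
      - inversion E; subst. now left.
      - right. exists T, a. easy. }
    simpl. apply Rmult_le_compat_r with (r := q) in H3; lra.
Qed.

(** A cover either pays the cap once, or pays at least [m ^ (-1/t)] per unit of content throughout,
    and then subadditivity of [C] applies. *)
Lemma Phi_ge h (E A : X -> Prop) (m : R) :
  (forall z, E z -> C (fun x => closed_ball z (radius h) x /\ E x) <= m) ->
  Rmin (cap h) (C A * Rpower m (- / INR t)) <= Phi h E A.
Proof.
  intros Hm. apply le_content; [apply price_ok|]. intros l [Hl Hc].
  destruct (classic (exists S, In (S, cap h) l)) as [[S HS]|Hno].
  - eapply Rle_trans; [apply Rmin_l|]. apply (cost_ge_item _ l S); [|easy].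
    intros S' c' Hin. eapply (proj1 (price_ok h E)), Hl, Hin.
  - eapply Rle_trans; [apply Rmin_r|]. apply C_le_sum; [left; apply exp_pos| |easy].
    intros S c Hin. destruct (Hl S c Hin) as [->|[z [Hz [_ ->]]]]; [destruct Hno; eauto|].
    apply Rmult_le_compat_l; [apply C_ge0|].
    apply Rpower_neg_le; [|now apply Hm|apply inv_t_ge0].
    apply (C_pos _ z). split; [apply ball_center; left; apply radius_pos|easy].
Qed.

(** Let [P j] be the relative ball about the maximising centre with [j] shells added, and [q] the
    ratio of the contents of [P t] and [P 0]. If every shell failed, each would multiply the content
    by more than [q ^ (1/t)], so all [t] together by more than [q]. *)
Lemma exists_cheap_shell (h : nat) (F : list X) (A : X -> Prop) (a : X) :
  (h < H)%nat -> (forall x, A x -> In x F) -> A a ->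
  exists z r, A z /\ 0 <= r /\
    let P := fun x => closed_ball z r x /\ A x in
    let Q := fun x => closed_ball z (r + gap h) x /\ A x in
    Phi (S h) A Q <= Phi h P P.
Proof.
  intros Hh HF Ha.
  destruct (finite_argmax X (fun z => C (fun x => closed_ball z (radius h) x /\ A x))
              F A a HF Ha) as [z [Hz Hmax]].
  set (P := fun (j : nat) x => closed_ball z (radius h + INR j * gap h) x /\ A x).
  set (m := C (P 0%nat)).
  assert (Em : C (fun x => closed_ball z (radius h) x /\ A x) <= m).
  { apply C_mono. intros x. unfold P. simpl. now rewrite Rmult_0_l, Rplus_0_r. }
  assert (Hr : forall j : nat, 0 <= radius h + INR j * gap h).
  { intros j. pose proof (radius_pos h). pose proof (gap_pos h). pose proof (pos_INR j).
    pose proof (Rmult_le_pos _ _ H2 (Rlt_le _ _ H1)). lra. }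
  assert (Pz : forall j, P j z) by (intros j; split; [apply ball_center, Hr|easy]).
  assert (Ppos : forall j, 0 < C (P j)) by (intros j; apply (C_pos _ z), Pz).
  apply NNPP. intros Hno.
  set (e := / INR t) in *.
  assert (Hbad : forall j, (j < t)%nat ->
    C (P j) * Rpower m (- e) < C (P (S j)) * Rpower (C (P t)) (- e)).
  { intros j Hj.
    assert (H1 : Phi h (P j) (P j) < Phi (S h) A (P (S j))).
    { apply Rnot_le_lt. intros Hle. apply Hno.
      exists z, (radius h + INR j * gap h). split; [easy|split; [apply Hr|]].
      simpl. fold (P j).
      refine (Rle_trans _ _ _ _ Hle). apply content_mono_set; [apply price_ok|].
      intros x. unfold P. rewrite S_INR.
      now replace (radius h + (INR j + 1) * gap h)
        with (radius h + INR j * gap h + gap h) by ring. }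
    assert (H2 : Phi (S h) A (P (S j)) <= C (P (S j)) * Rpower (C (P t)) (- e)).
    { apply (content_le_price _ _ _ (P (S j))); [apply price_ok| |easy].
      right. exists z. split; [easy|split].
      - intros x [Hx _]. unfold closed_ball in *. rewrite radius_S.
        eapply Rle_trans; [apply Hx|]. apply Rplus_le_compat_l.
        apply Rmult_le_compat_r; [left; apply gap_pos|]. now apply le_INR.
      - rewrite radius_S. reflexivity. }
    (* Hence the minimum in [H4] below cannot be the cap. *)
    assert (H3 : C (P (S j)) * Rpower (C (P t)) (- e) <= cap h).
    { apply Rle_trans with (Rpower (C (P t)) (1 - e)).
      - unfold Rminus. rewrite Rpower_plus, Rpower_1 by apply Ppos.
        apply Rmult_le_compat_r; [left; apply exp_pos|].
        apply C_mono. intros x [Hx HAx]. split; [|easy]. unfold closed_ball in *.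
        eapply Rle_trans; [apply Hx|]. apply Rplus_le_compat_l.
        apply Rmult_le_compat_r; [left; apply gap_pos|]. now apply le_INR.
      - apply (C_ball_le_cap h z (P t) z); [easy|apply Pz|].
        intros x [Hx _]. now rewrite radius_S. }
    (* By the choice of [z], no relative ball of this radius weighs more than [m]. *)
    assert (H4 : Rmin (cap h) (C (P j) * Rpower m (- e)) <= Phi h (P j) (P j)).
    { apply Phi_ge. intros y [_ Hy].
      eapply Rle_trans; [|apply Em].
      eapply Rle_trans; [|apply (Hmax y Hy)].
      apply C_mono. intros x [Hx1 [_ Hx2]]. easy. }
    apply (Rle_lt_trans _ _ _ H4) in H1. apply (Rlt_le_trans _ _ _ H1) in H2.
    unfold Rmin in H2. destruct (Rle_dec _ _); lra. }
  set (q := C (P t) / m).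
  assert (Hm0 : 0 < m) by apply Ppos.
  assert (Hq : 0 < q) by (apply Rdiv_lt_0_compat; [apply Ppos|easy]).
  assert (Hstep : forall j, (j < t)%nat -> Rpower q e * C (P j) < C (P (S j))).
  { intros j Hj. specialize (Hbad j Hj).
    assert (Eq : Rpower q e = Rpower (C (P t)) e * Rpower m (- e)).
    { unfold q, Rdiv. rewrite <- Rpower_mult_distr; [|apply Ppos|now apply Rinv_0_lt_compat].
      f_equal. unfold Rpower. rewrite ln_Rinv by easy. f_equal. ring. }
    assert (E1 : Rpower (C (P t)) e * Rpower (C (P t)) (- e) = 1).
    { rewrite <- Rpower_plus, Rplus_opp_r. apply Rpower_O, Ppos. }
    apply Rmult_lt_compat_l with (r := Rpower (C (P t)) e) in Hbad; [|apply exp_pos].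
    rewrite Eq.
    replace (C (P (S j))) with
      (Rpower (C (P t)) e * (C (P (S j)) * Rpower (C (P t)) (- e)))
      by (rewrite <- (Rmult_1_r (C (P (S j)))) at 2; rewrite <- E1; ring).
    lra. }
  assert (Hpow : forall j, (j <= t)%nat -> (0 < j)%nat -> Rpower q e ^ j * m < C (P j)).
  { induction j as [|[|j] IH]; intros Hj Hj0; [lia| |].
    - simpl. rewrite Rmult_1_r. now apply Hstep.
    - eapply Rle_lt_trans; [|apply Hstep; lia].
      change (Rpower q e ^ S (S j)) with (Rpower q e * Rpower q e ^ S j).
      rewrite Rmult_assoc. apply Rmult_le_compat_l; [left; apply exp_pos|].
      left. apply IH; lia. }
  specialize (Hpow t (le_n t) t_pos).
  rewrite <- Rpower_pow, Rpower_mult in Hpow by apply exp_pos.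
  unfold e in Hpow. rewrite Rinv_l in Hpow by (pose proof INR_t_pos; lra).
  rewrite Rpower_1 in Hpow by easy. unfold q, Rdiv in Hpow.
  rewrite Rmult_assoc, Rinv_l in Hpow; lra.
Qed.

Variable x0 : X.

Definition separated (h w : nat) (x : nat -> X) : Prop :=
  forall i j l, (i < j < w)%nat -> (l < h)%nat -> (K ^ l <= j - i)%nat ->
    gap l <= dist M (x i) (x j).

(** The outer induction is on the scale, the inner one on the length of a list containing [A]. The
    inside [P] of a cheap shell is listed by the outer hypothesis, the points beyond the shell by
    the inner one, and the two lists are concatenated. *)
Lemma separated_points (h : nat) (F : list X) (A : X -> Prop) :
  (h <= H)%nat -> (forall x, A x -> In x F) ->
  exists w x, (forall i, (i < w)%nat -> A (x i)) /\ (w <= K ^ h)%nat /\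
    Phi h A A <= INR w * u /\ separated h w x.
Proof.
  revert F A. induction h as [|h IHh]; intros F A Hh HF.
  - destruct (classic (exists a, A a)) as [[a Ha]|Hno].
    + exists 1%nat, (fun _ => a). repeat split; [easy|simpl; lia| |intros i j l ? ?; lia].
      exact (Phi_le_cap 0 A A).
    + exists 0%nat, (fun _ => x0). repeat split; [lia|simpl; lia| |intros i j l ? ?; lia].
      unfold Phi. rewrite content_empty; [simpl; lra|apply price_ok|].
      intros x Hx. eauto.
  - enough (Hun : exists w x, (forall i, (i < w)%nat -> A (x i)) /\
                    Phi (S h) A A <= INR w * u /\ separated (S h) w x).
    (* Truncating to [K ^ S h] points is harmless, since they already pay for the cap. *)
    { destruct Hun as [w [x [H1 [H2 H3]]]]. exists (Nat.min w (K ^ S h)), x.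
      repeat split.
      - intros i Hi. apply H1. lia.
      - lia.
      - destruct (Nat.min_spec w (K ^ S h)) as [[_ ->]|[_ ->]]; [easy|].
        apply Phi_le_cap.
      - intros i j l Hij. apply H3. lia. }
    remember (length F) as n eqn:En. revert F A HF En.
    induction n as [n IHn] using lt_wf_ind; intros F A HF En.
    destruct (classic (exists a, A a)) as [[a Ha]|Hno].
    2: { exists 0%nat, (fun _ => x0). repeat split; [lia| |intros i j l ? ?; lia].
         unfold Phi. rewrite content_empty; [simpl; lra|apply price_ok|].
         intros x Hx. eauto. }
    destruct (exists_cheap_shell h F A a) as [z [r [Hz [Hr HPQ]]]]; [lia|easy|easy|].
    set (P := fun x => closed_ball z r x /\ A x) in *.
    set (Q := fun x => closed_ball z (r + gap h) x /\ A x) in *.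
    simpl in HPQ. fold P Q in HPQ.
    set (A' := fun x => A x /\ ~ Q x).
    destruct (IHh F P) as [w1 [x1 [I1 [I2 [I3 I4]]]]];
      [lia|intros x [_ Hx]; auto|].
    destruct (in_split _ _ (HF z Hz)) as [F1 [F2 EF]].
    assert (Qz : Q z).
    { split; [|easy]. apply ball_center. pose proof (gap_pos h). lra. }
    destruct (IHn (length (F1 ++ F2))) with (F := F1 ++ F2) (A := A')
      as [w2 [x2 [J1 [J2 J3]]]]; [| |easy|].
    { rewrite En, EF, !length_app. simpl. lia. }
    { intros x [Hx HQx]. specialize (HF x Hx). rewrite EF in HF.
      apply in_app_or in HF as [|[<-|]]; [|easy|]; apply in_or_app; auto. }
    exists (w1 + w2)%nat, (fun i => if (i <? w1)%nat then x1 i else x2 (i - w1)%nat).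
    repeat split.
    + intros i Hi. destruct (Nat.ltb_spec i w1); [now apply I1|].
      apply J1. lia.
    + assert (Phi (S h) A A <= Phi (S h) A Q + Phi (S h) A A').
      { apply content_union; [apply price_ok|]. intros x Hx.
        destruct (classic (Q x)); [now left|right; split; easy]. }
      assert (Phi (S h) A A' <= Phi (S h) A' A')
        by (apply Phi_antitone; intros x [Hx _]; easy).
      rewrite plus_INR. lra.
    + intros i j l Hij Hl Hd.
      destruct (Nat.ltb_spec i w1) as [Hi|Hi], (Nat.ltb_spec j w1) as [Hj|Hj].
      (* Two indices of the first block differ by less than [K ^ h], as [w1 <= K ^ h], so scale [h]
         does not concern them. *)
      * destruct (Nat.eq_dec l h) as [->|]; [lia|]. apply I4; lia.
      (* The discarded shell, of width [gap h], lies between the two points. *)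
      * assert (Hji : (j - w1 < w2)%nat) by lia.
        apply Rle_trans with (gap h); [apply gap_mono; lia|].
        destruct (I1 i Hi) as [Hp _]. destruct (J1 _ Hji) as [Hp1 Hp2].
        unfold closed_ball in *.
        assert (~ dist M z (x2 (j - w1)%nat) <= r + gap h) by (intros ?; now apply Hp2).
        pose proof (dist_tri M z (x2 (j - w1)%nat) (x1 i)). lra.
      * lia.
      * apply J3; lia.
Qed.

End BallGrowing.

(** * Hausdorff content at a fixed resolution *)

Section HausdorffContent.

Variable M : Metric_Space.
Let X := Base M.

(* The price [1] for arbitrary sets makes every set coverable without assuming
   that the space is bounded. *)
Definition diam_price (delta s : R) (S : X -> Prop) (c : R) : Prop :=
  c = 1 \/
  exists d, delta <= d /\ (forall x y, S x -> S y -> dist M x y <= d) /\ c = Rpower d s.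

Lemma diam_price_ok delta s : price_system (diam_price delta s).
Proof.
  split.
  - intros S c [->|[d [_ [_ ->]]]]; [lra|left; apply exp_pos].
  - exists (fun _ => True), 1. split; [now left|easy].
Qed.

(** The floor [delta] on the diameters keeps all prices away from 0, so even a single point has
    positive content. *)
Lemma diam_content_pos delta s (A : X -> Prop) a :
  0 < delta -> 0 < s -> A a -> 0 < content (diam_price delta s) A.
Proof.
  intros Hd Hs Ha. apply Rlt_le_trans with (Rmin 1 (Rpower delta s)).
  - apply Rmin_glb_lt; [lra|apply exp_pos].
  - apply le_content; [apply diam_price_ok|]. intros l [Hl Hc].
    destruct (Hc a Ha) as [S [c [Hin _]]].
    apply Rle_trans with c.
    + destruct (Hl _ _ Hin) as [->|[d [Hd' [_ ->]]]]; [apply Rmin_l|].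
      eapply Rle_trans; [apply Rmin_r|]. apply Rle_Rpower_l; lra.
    + apply (cost_ge_item _ l S); [|easy].
      intros S' c' Hin'. eapply (proj1 (diam_price_ok delta s)), Hl, Hin'.
Qed.

Lemma finite_net (delta : R) : compact_space M -> 0 < delta ->
  exists F : list X, forall x, exists y, In y F /\ dist M x y < delta.
Proof.
  intros HM Hd. destruct (HM X (fun i x => dist M x i < delta)) as [F HF].
  - intros i x Hx. exists (delta - dist M x i). split; [lra|].
    intros y Hy. pose proof (dist_tri M y i x). rewrite (dist_sym M y x) in H. lra.
  - intros x. exists x. now rewrite dist_refl0.
  - exists F. easy.
Qed.

Lemma is_diam_exists (A : X -> Prop) (b : R) :
  0 <= b -> (forall x y, A x -> A y -> dist M x y <= b) ->
  exists r, is_diam M A r /\ 0 <= r <= b.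
Proof.
  intros Hb HA. destruct (classic (exists a, A a)) as [[a Ha]|Hno].
  - destruct (completeness (fun v => exists x y, A x /\ A y /\ v = dist M x y))
      as [r [Hr1 Hr2]].
    + exists b. intros v [x [y [Hx [Hy ->]]]]. auto.
    + exists (dist M a a), a, a. easy.
    + exists r. split; [right; split; easy|]. split.
      * apply Hr1. exists a, a. now rewrite dist_refl0.
      * apply Hr2. intros v [x [y [Hx [Hy ->]]]]. auto.
  - exists 0. split; [left; split; [eauto|easy]|lra].
Qed.

Lemma infinite_sum_cons (f : nat -> R) (a l : R) :
  infinite_sum f l ->
  infinite_sum (fun n => match n with O => a | S m => f m end) (a + l).
Proof.
  intros Hf eps He. destruct (Hf eps He) as [N HN]. exists (S N).
  intros [|n] Hn; [lia|].
  replace (sum_f_R0 _ (S n)) with (a + sum_f_R0 f n).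
  - unfold Rdist. replace (a + sum_f_R0 f n - (a + l)) with (sum_f_R0 f n - l) by ring.
    apply HN. lia.
  - clear. induction n as [|n IH]; [easy|].
    rewrite (tech5 f), <- Rplus_assoc, IH. reflexivity.
Qed.

(** Turns a cover of a net into one of the space: the [delta]-neighbourhood of a set of diameter at
    most [d] has diameter at most [d + 2 * delta <= 3 * d], which costs a factor [3 ^ s]. The list
    is padded to a sequence with empty sets. *)
Lemma thicken_cover (delta delta0 s : R) (l : list ((X -> Prop) * R)) :
  0 < delta -> 0 < delta0 -> 0 < s ->
  (forall S c, In (S, c) l -> exists d, delta <= d /\ 3 * d <= delta0 /\
     (forall x y, S x -> S y -> dist M x y <= d) /\ c = Rpower d s) ->
  exists (A : nat -> X -> Prop) (r : nat -> R) v,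
    (forall n, is_diam M (A n) (r n) /\ r n <= delta0) /\
    (forall S c x y, In (S, c) l -> S y -> dist M x y < delta -> exists n, A n x) /\
    infinite_sum (fun n => hpow (r n) s) v /\ v <= Rpower 3 s * cost l.
Proof.
  intros Hd Hd0 Hs. induction l as [|[S c] l IH]; intros Hl.
  - exists (fun _ _ => False), (fun _ => 0), 0.
    split; [intros _; split; [left; easy|lra]|split; [easy|split; [|simpl; lra]]].
    intros eps He. exists 0%nat. intros n _.
    rewrite sum_eq_R0.
    + unfold Rdist. rewrite Rminus_0_r, Rabs_R0. lra.
    + intros m _. unfold hpow. destruct (Rle_dec 0 0); lra.
  - destruct IH as [A [r [v [I1 [I2 [I3 I4]]]]]]; [intros; apply Hl; now right|].
    destruct (Hl S c) as [d [J1 [J2 [J3 J4]]]]; [now left|].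
    set (T := fun x => exists y, S y /\ dist M x y < delta).
    destruct (is_diam_exists T (3 * d)) as [q [Hq1 Hq2]].
    { lra. }
    { intros x x' [y [Hy Hxy]] [y' [Hy' Hxy']]. specialize (J3 y y' Hy Hy').
      pose proof (dist_tri M x x' y). pose proof (dist_tri M y x' y').
      rewrite (dist_sym M y' x') in H0. lra. }
    assert (Hh : hpow q s <= Rpower 3 s * c).
    { rewrite J4, Rpower_mult_distr by lra. unfold hpow.
      destruct (Rle_dec q 0); [left; apply exp_pos|]. apply Rle_Rpower_l; lra. }
    exists (fun n => match n with O => T | Datatypes.S m => A m end),
      (fun n => match n with O => q | Datatypes.S m => r m end), (hpow q s + v).
    split; [|split; [|split]].
    + intros [|n]; [split; [easy|lra]|apply I1].
    + intros S' c' x y [E|Hin] Hy Hxy.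
      * inversion E; subst. exists 0%nat, y. easy.
      * destruct (I2 S' c' x y Hin Hy Hxy) as [n Hn]. now exists (Datatypes.S n).
    + pose proof (infinite_sum_cons _ (hpow q s) v I3) as Hsum.
      intros eps He. destruct (Hsum eps He) as [N HN]. exists N. intros n Hn.
      specialize (HN n Hn). erewrite sum_eq; [exact HN|].
      intros [|i] _; easy.
    + simpl. lra.
Qed.

Lemma net_content_lower_bound (s : R) :
  0 < s -> ~ hausdorff_null M s ->
  exists c0, 0 < c0 /\ forall delta F, 0 < delta ->
    (forall x, exists y, In y F /\ dist M x y < delta) ->
    c0 <= content (diam_price delta s) (fun x => In x F).
Proof.
  intros Hs Hnull.
  assert (Hex : exists delta0 eps0, 0 < delta0 /\ 0 < eps0 /\
    ~ exists (A : nat -> Base M -> Prop) (r : nat -> R),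
      (forall n, is_diam M (A n) (r n) /\ r n <= delta0) /\
      (forall x, exists n, A n x) /\
      exists l, infinite_sum (fun n => hpow (r n) s) l /\ l < eps0).
  { apply NNPP. intros Hno. apply Hnull. intros delta eps Hd He.
    apply NNPP. intros Hno'. apply Hno. exists delta, eps. easy. }
  destruct Hex as [delta0 [eps0 [Hd0 [He0 Hno]]]].
  (* A cheaper cover avoids the price 1, uses only diameters below [delta0 / 3], and still costs
     less than [eps0] after thickening. *)
  exists (Rmin 1 (Rmin (Rpower (delta0 / 3) s) (eps0 / Rpower 3 s))).
  assert (H3 : 0 < Rpower 3 s) by apply exp_pos.
  split.
  { repeat apply Rmin_glb_lt; [lra|apply exp_pos|now apply Rdiv_lt_0_compat]. }
  intros delta F Hd HF. apply le_content; [apply diam_price_ok|].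
  intros l [Hl Hc]. apply Rnot_lt_le. intros Hlt.
  assert (L1 : cost l < 1) by (eapply Rlt_le_trans; [apply Hlt|apply Rmin_l]).
  assert (L2 : cost l < Rmin (Rpower (delta0 / 3) s) (eps0 / Rpower 3 s))
    by (eapply Rlt_le_trans; [apply Hlt|apply Rmin_r]).
  assert (L3 : cost l < Rpower (delta0 / 3) s)
    by (eapply Rlt_le_trans; [apply L2|apply Rmin_l]).
  assert (L4 : cost l < eps0 / Rpower 3 s)
    by (eapply Rlt_le_trans; [apply L2|apply Rmin_r]).
  assert (Hi : forall S c, In (S, c) l -> c <= cost l).
  { intros S c Hin. apply (cost_ge_item _ l S); [|easy].
    intros S' c' Hin'. eapply (proj1 (diam_price_ok delta s)), Hl, Hin'. }
  destruct (thicken_cover delta delta0 s l) as [A [r [v [I1 [I2 [I3 I4]]]]]]; auto.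
  { intros S c Hin. specialize (Hi S c Hin).
    destruct (Hl S c Hin) as [->|[d [Hd1 [Hd2 Hd3]]]]; [lra|].
    exists d. repeat split; auto.
    enough (~ delta0 / 3 <= d) by lra. intros Hle.
    assert (Rpower (delta0 / 3) s <= Rpower d s) by (apply Rle_Rpower_l; lra). lra. }
  apply Hno. exists A, r. split; [easy|split].
  - intros x. destruct (HF x) as [y [Hy Hxy]].
    destruct (Hc y Hy) as [S [c [Hin HS]]]. eauto.
  - exists v. split; [easy|].
    apply Rmult_lt_compat_r with (r := Rpower 3 s) in L4; [|easy].
    unfold Rdiv in L4. rewrite Rmult_assoc, Rinv_l in L4 by lra. lra.
Qed.

Lemma large_separated_sequences (s : R) (k t : nat) :
  compact_space M -> 0 < s -> ~ hausdorff_null M s -> (0 < t)%nat ->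
  INR k <= s * (1 - / INR t) ->
  exists kappa, 0 < kappa /\ forall H : nat, exists w (x : nat -> X),
    kappa * 3 ^ (k * H) <= INR w /\
    forall i j l, (i < j < w)%nat -> (l < H)%nat -> ((3 ^ k) ^ l <= j - i)%nat ->
      2 * 3 ^ l / 3 ^ H / INR t <= dist M (x i) (x j).
Proof.
  intros HM Hs Hnull Ht Hk.
  destruct (net_content_lower_bound s Hs Hnull) as [c0 [Hc0 HF0]].
  set (e := / INR t) in *. set (s1 := s * (1 - e)) in *.
  assert (He : 0 <= 1 - e).
  { assert (1 <= INR t) by (change 1 with (INR 1); apply le_INR; lia).
    assert (e <= / 1) by (apply Rinv_le_contravar; lra). rewrite Rinv_1 in *. lra. }
  (* A lower bound for [Phi] of the net at the top scale [H], where the radius is 1 and the cap is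
     [6 ^ s1]. *)
  set (b := Rmin (Rpower 6 s1) (Rpower c0 (1 - e))).
  assert (H6 : 0 < Rpower 6 s1) by apply exp_pos.
  exists (b / Rpower 6 s1). split.
  { apply Rdiv_lt_0_compat; [|easy]. apply Rmin_glb_lt; apply exp_pos. }
  intros H. set (delta := / 3 ^ H).
  assert (H3 : 0 < 3 ^ H) by (apply pow_lt; lra).
  assert (Hd : 0 < delta) by now apply Rinv_0_lt_compat.
  destruct (finite_net delta HM Hd) as [F HF].
  specialize (HF0 delta F Hd HF).
  set (C := content (diam_price delta s)).
  assert (Hok := diam_price_ok delta s).
  assert (HFne : exists x0, In x0 F).
  { destruct F as [|x0 F]; [|exists x0; now left].
    rewrite content_empty in HF0; [lra|easy|intros x []]. }
  destruct HFne as [x0 Hx0].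
  set (u := Rpower 6 s1 * delta ^ k).
  assert (Hu : 0 < u) by (apply Rmult_lt_0_compat; [easy|now apply pow_lt]).
  assert (Ecap : forall h, cap (3 ^ k) u h = Rpower 6 s1 * (3 ^ h * delta) ^ k).
  { intros h. unfold cap, u. rewrite <- Nat.pow_mul_r, pow_INR, Rpow_mult_distr, <- pow_mult.
    rewrite (Nat.mul_comm h). replace (INR 3) with 3 by (simpl; lra). ring. }
  assert (Hpos : forall (A : X -> Prop) a, A a -> 0 < C A)
    by (intros A a Ha; now apply (diam_content_pos delta s A a)).
  destruct (separated_points M C) with (t := t) (r0 := delta) (K := (3 ^ k)%nat)
    (u := u) (H := H) (h := H) (F := F) (A := fun x => In x F)
    as [w [x [I1 [I2 [I3 I4]]]]]; auto.
  - intros A. now apply content_ge0.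
  - intros A HA. now apply content_empty.
  - intros A B. now apply content_mono_set.
  - intros A B D. now apply content_union.
  - intros h z A a Hh Ha HA. rewrite Ecap. fold e.
    assert (Hb : 0 < 3 ^ h * delta) by (apply Rmult_lt_0_compat; [apply pow_lt; lra|easy]).
    assert (Hb1 : 3 ^ h * delta <= 1).
    { unfold delta. rewrite <- (Rinv_r (3 ^ H)) by lra.
      apply Rmult_le_compat_r; [now left|]. apply Rle_pow; [lra|lia]. }
    set (bb := 3 ^ h * delta) in *.
    apply Rle_trans with (Rpower (Rpower (6 * bb) s) (1 - e)).
    + apply Rle_Rpower_l; [easy|]. split; [now apply (Hpos A a)|].
      apply (content_le_price _ _ _ A); [easy| |easy]. right.
      (* The diameter bound for a ball of radius [3 * bb]. *)
      exists (6 * bb). split; [|split; [|easy]].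
      * unfold bb. assert (1 <= 3 ^ h) by (apply pow_R1_Rle; lra). nra.
      * intros y y' Hy Hy'. apply HA in Hy, Hy'. unfold closed_ball, radius in Hy, Hy'.
        simpl in Hy, Hy'. pose proof (dist_tri M y y' z). rewrite (dist_sym M y z) in H0.
        unfold bb. lra.
    + rewrite Rpower_mult. fold s1. rewrite <- Rpower_mult_distr by lra.
      apply Rmult_le_compat_l; [lra|]. rewrite <- Rpower_pow by easy.
      unfold Rpower. destruct (Rle_lt_or_eq_dec bb 1 Hb1) as [Hlt| ->].
      (* Since [bb <= 1] and [k <= s1], the power [s1] of [bb] is at most its power [k]. *)
      * apply ln_increasing in Hlt; [rewrite ln_1 in Hlt|easy].
        assert (Hm : s1 * ln bb <= INR k * ln bb) by nra.
        destruct Hm as [Hm|Hm]; [left; now apply exp_increasing|rewrite Hm; lra].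
      * rewrite ln_1, !Rmult_0_r. lra.
  - exists w, x. split.
    + assert (HPhi : Rmin (cap (3 ^ k) u H)
                  (C (fun x => In x F) * Rpower (C (fun x => In x F)) (- / INR t))
                <= Phi M C t delta (3 ^ k) u H (fun x => In x F) (fun x => In x F)).
      { apply Phi_ge; auto.
        - intros A. now apply content_ge0.
        - intros A HA. now apply content_empty.
        - intros A B D. now apply content_union.
        - intros z _. apply content_mono_set; [easy|]. intros y [_ Hy]. easy. }
      assert (Hbu : b <= INR w * u).
      { eapply Rle_trans; [|apply I3]. eapply Rle_trans; [|apply HPhi].
        apply Rmin_glb.
        - eapply Rle_trans; [apply Rmin_l|]. rewrite Ecap. unfold delta.
          rewrite Rinv_r, pow1 by lra. lra.
        - eapply Rle_trans; [apply Rmin_r|].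
          rewrite <- (Rpower_1 (C _)) at 1 by now apply (Hpos _ x0).
          rewrite <- Rpower_plus. apply Rle_Rpower_l; [easy|]. split; easy. }
      assert (E3 : delta ^ k * 3 ^ (k * H) = 1).
      { rewrite Nat.mul_comm, pow_mult, <- Rpow_mult_distr. unfold delta.
        rewrite Rinv_l, pow1 by lra. easy. }
      assert (H3k : 0 < 3 ^ (k * H)) by (apply pow_lt; lra).
      unfold Rdiv. apply Rmult_le_reg_r with (Rpower 6 s1); [easy|].
      replace (b * / Rpower 6 s1 * 3 ^ (k * H) * Rpower 6 s1) with (b * 3 ^ (k * H))
        by (field; lra).
      apply Rmult_le_compat_r with (r := 3 ^ (k * H)) in Hbu; [|lra].
      eapply Rle_trans; [apply Hbu|]. right. unfold u.
      replace (INR w * (Rpower 6 s1 * delta ^ k) * 3 ^ (k * H))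
        with (INR w * Rpower 6 s1 * (delta ^ k * 3 ^ (k * H))) by ring.
      rewrite E3. ring.
    + intros i j l Hij Hl Hd'. specialize (I4 i j l Hij Hl Hd').
      eapply Rle_trans; [|apply I4]. right. unfold gap, radius, delta, Rdiv. ring.
Qed.

End HausdorffContent.

(** * From separated points to a Lipschitz surjection *)

Definition in_cube (k : nat) (y : nat -> R) : Prop :=
  forall c, (c < k)%nat -> 0 <= y c <= 1.

Lemma nat_below (n : nat) (v : R) :
  (0 < n)%nat -> 0 <= v <= INR n -> exists g, (g < n)%nat /\ INR g <= v <= INR g + 1.
Proof.
  induction n as [|n IH]; intros Hn Hv; [lia|].
  rewrite S_INR in Hv. destruct (Rle_or_lt v (INR n)) as [Hle|Hlt].
  - destruct n as [|n].
    + exists 0%nat. split; [lia|]. simpl in *. lra.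
    + destruct IH as [g [Hg Hv']]; [lia|lra|]. exists g. split; [lia|easy].
  - exists n. split; [lia|lra].
Qed.

Lemma pow_bracket (K n p : nat) :
  (0 < n < K ^ p)%nat -> exists l, (l < p)%nat /\ (K ^ l <= n < K ^ S l)%nat.
Proof.
  induction p as [|p IH]; intros Hn; [simpl in Hn; lia|].
  destruct (Nat.lt_ge_cases n (K ^ p)) as [Hlt|Hge].
  - destruct IH as [l [Hl Hb]]; [lia|]. exists l. split; [lia|easy].
  - exists p. split; [lia|easy].
Qed.

(** Take [l] with [3 ^ (k * l) <= |i - j| < 3 ^ (k * (l + 1))]. The points are then at distance at
    least a constant times [3 ^ (l - p)], while the cells differ by less than [2 * 3 ^ (l + 1)] in
    each coordinate. *)
Lemma peano_separation (M : Metric_Space) (k t a p w i j c : nat) (x : nat -> Base M) :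
  (0 < t)%nat -> (3 ^ (k * p) <= w)%nat ->
  (forall i j l, (i < j < w)%nat -> (l < p + a)%nat -> ((3 ^ k) ^ l <= j - i)%nat ->
     2 * 3 ^ l / 3 ^ (p + a) / INR t <= dist M (x i) (x j)) ->
  (c < k)%nat -> (i < 3 ^ (k * p))%nat -> (j < 3 ^ (k * p))%nat ->
  Rabs (INR (peano k (k * p) i c) - INR (peano k (k * p) j c))
    <= 3 * INR t * 3 ^ a * 3 ^ p * dist M (x i) (x j).
Proof.
  intros Ht Hw Hx Hc.
  assert (HL : 0 <= 3 * INR t * 3 ^ a * 3 ^ p).
  { repeat apply Rmult_le_pos; try apply pos_INR; try (apply pow_le; lra); lra. }
  assert (Hmain : forall i j, (i < j)%nat -> (j < 3 ^ (k * p))%nat ->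
    Rabs (INR (peano k (k * p) i c) - INR (peano k (k * p) j c))
    <= 3 * INR t * 3 ^ a * 3 ^ p * dist M (x i) (x j)).
  { clear i j. intros i j Hij Hj.
    destruct (pow_bracket (3 ^ k) (j - i) p) as [l [Hl [Hl1 Hl2]]];
      [rewrite <- Nat.pow_mul_r; lia|].
    specialize (Hx i j l ltac:(lia) ltac:(lia) Hl1).
    destruct (peano_holder k (k * p) (k * S l) i j c) as [P1 P2];
      [nia|lia|lia|rewrite Nat.pow_mul_r; lia|].
    rewrite (side_mul k c (S l) Hc) in P1, P2.
    apply lt_INR in P1, P2. rewrite plus_INR, mult_INR, pow_INR in P1, P2.
    simpl in P1, P2.
    assert (Hd : 3 ^ l <= INR t / 2 * 3 ^ a * 3 ^ p * dist M (x i) (x j)).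
    { assert (0 < INR t) by now apply lt_0_INR.
      assert (0 < 3 ^ a * 3 ^ p) by (apply Rmult_lt_0_compat; apply pow_lt; lra).
      rewrite pow_add in Hx.
      apply Rmult_le_compat_l with (r := INR t / 2 * 3 ^ a * 3 ^ p) in Hx.
      - eapply Rle_trans; [|apply Hx]. right. field.
        repeat split; try lra; apply pow_nonzero; lra.
      - rewrite Rmult_assoc. apply Rmult_le_pos; lra. }
    apply Rabs_le. replace (1 + 1 + 1) with 3 in P1, P2 by ring.
    replace (3 * INR t * 3 ^ a * 3 ^ p * dist M (x i) (x j))
      with (6 * (INR t / 2 * 3 ^ a * 3 ^ p * dist M (x i) (x j))) by field.
    lra. }
  intros Hi Hj. destruct (Nat.lt_trichotomy i j) as [Hlt|[->|Hgt]].
  - now apply Hmain.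
  - rewrite Rminus_diag, Rabs_R0. apply Rmult_le_pos; [easy|].
    apply Rge_le, dist_pos.
  - rewrite Rabs_minus_sym, dist_sym. now apply Hmain.
Qed.

Lemma approximate_cube (M : Metric_Space) (s : R) (k t : nat) :
  compact_space M -> (0 < k)%nat -> 0 < s -> ~ hausdorff_null M s -> (0 < t)%nat ->
  INR k <= s * (1 - / INR t) ->
  exists L, 0 <= L /\ forall p : nat, exists x : (nat -> R) -> Base M,
    forall y z c, in_cube k y -> in_cube k z -> (c < k)%nat ->
      Rabs (y c - z c) <= L * dist M (x y) (x z) + / 3 ^ p.
Proof.
  intros HM Hk Hs Hnull Ht Hks.
  destruct (large_separated_sequences M s k t HM Hs Hnull Ht Hks) as [kappa [Hkap Hseq]].
  (* Refining the resolution by [a] further scales, independently of [p], provides a point for each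
     of the [3 ^ (k * p)] cells. *)
  assert (Ha : exists a, 1 <= kappa * 3 ^ (k * a)).
  { destruct (Pow_x_infinity 3) with (b := / kappa) as [a Ha];
      [rewrite Rabs_right; lra|].
    exists a. specialize (Ha (k * a)%nat ltac:(nia)).
    rewrite Rabs_right in Ha by (apply Rle_ge, pow_le; lra).
    apply Rge_le, Rmult_le_compat_l with (r := kappa) in Ha; [|lra].
    rewrite Rinv_r in Ha; lra. }
  destruct Ha as [a Ha].
  exists (3 * INR t * 3 ^ a). split.
  { repeat apply Rmult_le_pos; try apply pos_INR; try (apply pow_le; lra); lra. }
  intros p. destruct (Hseq (p + a)%nat) as [w [x [Hw Hx]]].
  assert (Hwp : (3 ^ (k * p) <= w)%nat).
  { apply INR_le. rewrite pow_INR. replace (INR 3) with 3 by (simpl; lra).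
    eapply Rle_trans; [|apply Hw]. rewrite Nat.mul_add_distr_l, pow_add.
    assert (0 < 3 ^ (k * p)) by (apply pow_lt; lra). nra. }
  assert (H3 : 0 < 3 ^ p) by (apply pow_lt; lra).
  assert (Hidx : forall y, in_cube k y -> exists i, (i < 3 ^ (k * p))%nat /\
    forall c, (c < k)%nat -> INR (peano k (k * p) i c) <= y c * 3 ^ p
                             <= INR (peano k (k * p) i c) + 1).
  { intros y Hy.
    set (Pg := fun c g => (g < 3 ^ p)%nat /\ INR g <= y c * 3 ^ p <= INR g + 1).
    set (g := fun c => epsilon (inhabits 0%nat) (Pg c)).
    assert (Hg : forall c, (c < k)%nat -> Pg c (g c)).
    { intros c Hc. apply epsilon_spec. specialize (Hy c Hc).
      destruct (nat_below (3 ^ p) (y c * 3 ^ p)) as [v Hv].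
      - apply pow3_pos.
      - rewrite pow_INR. replace (INR 3) with 3 by (simpl; lra). nra.
      - now exists v. }
    destruct (peano_surjective k (k * p) g Hk) as [i [Hi Hgi]].
    - intros c Hc. rewrite side_mul by easy. now apply Hg.
    - exists i. split; [easy|]. intros c Hc. rewrite Hgi by easy. now apply Hg. }
  set (Pi := fun y i => (i < 3 ^ (k * p))%nat /\
    forall c, (c < k)%nat -> INR (peano k (k * p) i c) <= y c * 3 ^ p
                             <= INR (peano k (k * p) i c) + 1).
  exists (fun y => x (epsilon (inhabits 0%nat) (Pi y))).
  intros y z c Hy Hz Hc.
  destruct (epsilon_spec (inhabits 0%nat) (Pi y) (Hidx y Hy)) as [Hi Hi'].
  destruct (epsilon_spec (inhabits 0%nat) (Pi z) (Hidx z Hz)) as [Hj Hj'].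
  set (i := epsilon _ (Pi y)) in *. set (j := epsilon _ (Pi z)) in *.
  specialize (Hi' c Hc). specialize (Hj' c Hc).
  pose proof (peano_separation M k t a p w i j c x Ht Hwp Hx Hc Hi Hj) as Hsep.
  (* Both coordinates are rounded in the same direction, so the error is 1 rather than 2. *)
  assert (Hd : Rabs (y c * 3 ^ p - z c * 3 ^ p)
            <= 3 * INR t * 3 ^ a * 3 ^ p * dist M (x i) (x j) + 1).
  { unfold Rabs in Hsep. destruct (Rcase_abs _) in Hsep; apply Rabs_le; lra. }
  rewrite <- Rmult_minus_distr_r, Rabs_mult, (Rabs_right (3 ^ p)) in Hd by lra.
  apply Rmult_le_reg_r with (3 ^ p); [easy|].
  rewrite Rmult_plus_distr_r, Rinv_l by lra. lra.
Qed.

(** * Limits along a free ultrafilter *)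

Record free_ultrafilter (U : (nat -> Prop) -> Prop) : Prop := {
  ultra_ex : forall A, U A -> exists n, A n;
  ultra_up : forall A B : nat -> Prop, (forall n, A n -> B n) -> U A -> U B;
  ultra_cap : forall A B : nat -> Prop, U A -> U B -> U (fun n => A n /\ B n);
  ultra_dec : forall A : nat -> Prop, U A \/ U (fun n => ~ A n);
  ultra_tail : forall N, U (fun n => (N <= n)%nat)
}.

Lemma free_ultrafilter_exists : exists U, free_ultrafilter U.
Proof.
  destruct (filter.ultraFilterLemma (T := nat)
    (F := fun A => exists N, forall n, (N <= n)%nat -> A n)) as [U [HU Hsub]].
  - split.
    + intros [N HN]. exact (HN N (le_n N)).
    + split.
      * now exists 0%nat.
      * intros A B [N1 H1] [N2 H2]. exists (N1 + N2)%nat. intros n Hn.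
        split; [apply H1|apply H2]; lia.
      * intros A B HAB [N HN]. exists N. intros n Hn. apply HAB, HN, Hn.
  - exists U. split.
    + intros A HA. apply NNPP. intros Hno.
      apply (filter.filter_not_empty U).
      refine (filter.filterS _ HA). intros n Hn. apply Hno. now exists n.
    + intros A B HAB. exact (filter.filterS HAB).
    + intros A B HA HB. exact (filter.filterI HA HB).
    + intros A. exact (filter.in_ultra_setVsetC A HU).
    + intros N. apply Hsub. now exists N.
Qed.

(** Otherwise the balls whose index sets are not in [U] cover the space; finitely many of them
    suffice, and some [a n] would avoid them all. *)
Lemma ultralimit (M : Metric_Space) (U : (nat -> Prop) -> Prop) (a : nat -> Base M) :
  compact_space M -> free_ultrafilter U ->
  exists z, forall eps, 0 < eps -> U (fun n => dist M z (a n) < eps).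
Proof.
  intros HM HU. apply NNPP. intros Hno.
  set (small := fun (q : Base M * R) => ~ U (fun n => dist M (fst q) (a n) < snd q)).
  destruct (HM {q | small q} (fun i x => dist M (fst (proj1_sig i)) x < snd (proj1_sig i)))
    as [l Hl].
  - intros i x Hx. exists (snd (proj1_sig i) - dist M (fst (proj1_sig i)) x).
    split; [lra|]. intros y Hy. pose proof (dist_tri M (fst (proj1_sig i)) y x). lra.
  - intros x. apply NNPP. intros Hx. apply Hno. exists x. intros eps He.
    apply NNPP. intros HUx. apply Hx. exists (exist small (x, eps) HUx). simpl.
    now rewrite dist_refl0.
  - assert (HT : U (fun n => forall i, In i l ->
                    ~ dist M (fst (proj1_sig i)) (a n) < snd (proj1_sig i))).
    { clear Hl. induction l as [|i l IH].
      - refine (ultra_up U HU _ _ _ (ultra_tail U HU 0)). intros n _ i [].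
      - destruct (ultra_dec U HU
          (fun n => dist M (fst (proj1_sig i)) (a n) < snd (proj1_sig i)))
          as [HF|HF]; [now destruct (proj2_sig i)|].
        refine (ultra_up U HU _ _ _ (ultra_cap U HU _ _ HF IH)).
        intros n [H1 H2] j [<-|Hj]; auto. }
    destruct (ultra_ex U HU _ HT) as [n Hn].
    destruct (Hl (a n)) as [i [Hi Hin]]. exact (Hn i Hi Hin).
Qed.

(** A single ultrafilter gives limits at the uncountably many points of the cube simultaneously, and
    the error [3 ^ (-p)] vanishes in the limit. *)
Lemma expanding_cube (M : Metric_Space) (k : nat) (L : R) :
  compact_space M -> 0 <= L ->
  (forall p : nat, exists x : (nat -> R) -> Base M,
    forall y z c, in_cube k y -> in_cube k z -> (c < k)%nat ->
      Rabs (y c - z c) <= L * dist M (x y) (x z) + / 3 ^ p) ->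
  exists x : (nat -> R) -> Base M,
    forall y z c, in_cube k y -> in_cube k z -> (c < k)%nat ->
      Rabs (y c - z c) <= L * dist M (x y) (x z).
Proof.
  intros HM HL Happ.
  destruct free_ultrafilter_exists as [U HU].
  destruct (Happ 0%nat) as [x0 _].
  set (app := fun p (x : (nat -> R) -> Base M) => forall y z c,
    in_cube k y -> in_cube k z -> (c < k)%nat ->
      Rabs (y c - z c) <= L * dist M (x y) (x z) + / 3 ^ p).
  set (x := fun p => epsilon (inhabits x0) (app p)).
  assert (Hx : forall p, app p (x p)) by (intros p; apply epsilon_spec, Happ).
  set (is_lim := fun y z => forall eps, 0 < eps -> U (fun n => dist M z (x n y) < eps)).
  exists (fun y => epsilon (inhabits (x0 y)) (is_lim y)).
  assert (Hlim : forall y, is_lim y (epsilon (inhabits (x0 y)) (is_lim y))).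
  { intros y. apply epsilon_spec. now apply (ultralimit M U (fun n => x n y)). }
  intros y z c Hy Hz Hc.
  set (y' := epsilon _ (is_lim y)). set (z' := epsilon _ (is_lim z)).
  assert (Hy' : is_lim y y') by apply Hlim. assert (Hz' : is_lim z z') by apply Hlim.
  apply Rle_plus_epsilon. intros eps He.
  (* The two limits contribute [2 * L * eta] and the error [3 ^ (-n)] contributes [eta]. *)
  set (eta := eps / (2 * L + 1)).
  assert (Heta : 0 < eta) by (apply Rdiv_lt_0_compat; lra).
  destruct (pow_lt_1_zero (/ 3)) with (y := eta) as [N HN];
    [rewrite Rabs_right; lra|easy|].
  destruct (ultra_ex U HU _ (ultra_cap U HU _ _ (ultra_tail U HU N)
    (ultra_cap U HU _ _ (Hy' eta Heta) (Hz' eta Heta)))) as [n [Hn [H1 H2]]].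
  specialize (Hx n y z c Hy Hz Hc). specialize (HN n Hn).
  rewrite Rabs_right in HN by (apply Rle_ge, pow_le; lra).
  rewrite pow_inv in HN.
  assert (Hd : dist M (x n y) (x n z) <= dist M y' z' + 2 * eta).
  { pose proof (dist_tri M (x n y) (x n z) y'). pose proof (dist_tri M y' (x n z) z').
    rewrite (dist_sym M (x n y) y') in H. lra. }
  apply Rmult_le_compat_l with (r := L) in Hd; [|easy].
  assert (E : L * (2 * eta) + eta = eps) by (unfold eta; field; lra).
  lra.
Qed.

(** * McShane's extension *)

Section McShane.

Variables (M : Metric_Space) (k : nat) (L : R) (x : (nat -> R) -> Base M).
Hypothesis L_ge0 : 0 <= L.
Hypothesis x_expanding : forall y z c, in_cube k y -> in_cube k z -> (c < k)%nat ->
  Rabs (y c - z c) <= L * dist M (x y) (x z).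

Definition mcshane (z : Base M) (c : nat) : R :=
  Rinf (fun v => exists y, in_cube k y /\ v = y c + L * dist M z (x y)).

(** McShane's function may exceed 1 off the image of [x]; this retraction restores the range without
    raising the Lipschitz constant. *)
Definition clamp (v : R) : R := Rmax 0 (Rmin 1 v).

Lemma clamp_lipschitz a b d : a <= b + d -> 0 <= d -> clamp a <= clamp b + d.
Proof. unfold clamp, Rmax, Rmin. repeat destruct (Rle_dec _ _); lra. Qed.

Lemma mcshane_is_glb z c : (c < k)%nat ->
  is_glb (fun v => exists y, in_cube k y /\ v = y c + L * dist M z (x y)) (mcshane z c).
Proof.
  intros Hc. apply (Rinf_is_glb _ 0 (0 + L * dist M z (x (fun _ => 0)))).
  - exists (fun _ => 0). split; [|easy]. intros i _. lra.
  - intros v [y [Hy ->]]. specialize (Hy c Hc).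
    pose proof (Rmult_le_pos _ _ L_ge0 (Rge_le _ _ (dist_pos M z (x y)))). lra.
Qed.

Lemma mcshane_lipschitz z z' c : (c < k)%nat ->
  mcshane z c <= mcshane z' c + L * dist M z z'.
Proof.
  intros Hc. enough (mcshane z c - L * dist M z z' <= mcshane z' c) by lra.
  apply (mcshane_is_glb z' c Hc). intros v [y [Hy ->]].
  enough (mcshane z c <= y c + L * dist M z (x y)).
  { pose proof (Rmult_le_compat_l L _ _ L_ge0 (dist_tri M z (x y) z')). lra. }
  apply (mcshane_is_glb z c Hc). eauto.
Qed.

Lemma mcshane_extends y c : in_cube k y -> (c < k)%nat -> mcshane (x y) c = y c.
Proof.
  intros Hy Hc. destruct (mcshane_is_glb (x y) c Hc) as [H1 H2].
  apply Rle_antisym.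
  - apply H1. exists y. split; [easy|]. rewrite dist_refl0. ring.
  - apply H2. intros v [z [Hz ->]].
    pose proof (x_expanding y z c Hy Hz Hc). pose proof (Rle_abs (y c - z c)). lra.
Qed.

Lemma sum_upto_le (n : nat) (g : nat -> R) (b : R) :
  (forall i, (i < n)%nat -> g i <= b) -> sum_upto n g <= INR n * b.
Proof.
  induction n as [|n IH]; intros Hg; [simpl; lra|].
  rewrite S_INR. change (sum_upto (S n) g) with (sum_upto n g + g n).
  assert (g n <= b) by (apply Hg; lia).
  assert (sum_upto n g <= INR n * b) by (apply IH; intros; apply Hg; lia). lra.
Qed.

Lemma lipschitz_onto_cube : (0 < k)%nat ->
  exists f : Base M -> nat -> R, lipschitz_to_Rk M k f /\ image_is_unit_cube M k f.
Proof.
  intros Hk. exists (fun z c => clamp (mcshane z c)). split; [|split].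
  (* The coordinates give [sqrt k * L], and [sqrt k <= k] as [1 <= k]. *)
  - exists (INR k * L). split; [apply Rmult_le_pos; [apply pos_INR|easy]|].
    intros z z'. unfold eucl_dist. pose proof (Rge_le _ _ (dist_pos M z z')) as Hd.
    assert (HLd : 0 <= L * dist M z z') by now apply Rmult_le_pos.
    assert (H1 : 1 <= INR k) by (change 1 with (INR 1); apply le_INR; lia).
    rewrite Rmult_assoc, <- (sqrt_Rsqr (INR k * (L * dist M z z')))
      by (apply Rmult_le_pos; lra).
    apply sqrt_le_1_alt.
    eapply Rle_trans; [apply (sum_upto_le _ _ ((L * dist M z z') ^ 2))|].
    + intros c Hc. rewrite <- (pow2_abs (_ - _)). apply pow_incr. split; [apply Rabs_pos|].
      pose proof (clamp_lipschitz _ _ _ (mcshane_lipschitz z z' c Hc) HLd).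
      pose proof (mcshane_lipschitz z' z c Hc) as H2. rewrite (dist_sym M z' z) in H2.
      pose proof (clamp_lipschitz _ _ _ H2 HLd).
      apply Rabs_le. lra.
    + unfold Rsqr.
      replace (INR k * (L * dist M z z') * (INR k * (L * dist M z z')))
        with (INR k * INR k * (L * dist M z z') ^ 2) by ring.
      apply Rmult_le_compat_r; [apply pow2_ge_0|]. nra.
  - intros z c _. unfold clamp, Rmax, Rmin. repeat destruct (Rle_dec _ _); lra.
  - intros y Hy. exists (x y). intros c Hc. rewrite mcshane_extends by easy.
    specialize (Hy c Hc). unfold clamp, Rmax, Rmin. repeat destruct (Rle_dec _ _); lra.
Qed.

End McShane.

Theorem theorem1p1 (M : Metric_Space) (k : nat) (D : ereal) :
  compact_space M ->
  (0 < k)%nat ->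
  is_hausdorff_dim M D ->
  ereal_lt (Fin (INR k)) D ->
  exists f : Base M -> nat -> R,
    lipschitz_to_Rk M k f /\ image_is_unit_cube M k f.
Proof.
  intros HM Hk Hdim Hlt.
  assert (Hk0 : 0 < INR k) by now apply lt_0_INR.
  assert (Hs : exists s, INR k < s /\ ~ hausdorff_null M s).
  { destruct D as [m|]; simpl in *.
    - exists ((INR k + m) / 2). split; [lra|]. intros Hn.
      assert (m <= (INR k + m) / 2) by (apply Hdim; split; [lra|easy]). lra.
    - exists (INR k + 1). split; [lra|]. intros Hn. apply (Hdim (INR k + 1)).
      split; [lra|easy]. }
  destruct Hs as [s [Hks Hnull]].
  (* Any [t] with [s / t < s - k] will do. *)
  assert (Ht : exists t, (0 < t)%nat /\ INR k <= s * (1 - / INR t)).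
  { destruct (archimed_cor1 ((s - INR k) / s)) as [t [Ht1 Ht2]].
    - apply Rdiv_lt_0_compat; lra.
    - exists t. split; [easy|].
      apply Rmult_lt_compat_l with (r := s) in Ht1; [|lra].
      replace (s * ((s - INR k) / s)) with (s - INR k) in Ht1 by (field; lra). lra. }
  destruct Ht as [t [Ht Hkt]].
  destruct (approximate_cube M s k t HM Hk ltac:(lra) Hnull Ht Hkt) as [L [HL Happ]].
  destruct (expanding_cube M k L HM HL Happ) as [x Hx].
  exact (lipschitz_onto_cube M k L x HL Hx Hk).
Qed.
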